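(* Let $K$ be a field, let $k,\ell,d$ be integers with $2\le k\le \ell\le d$, and let $R$, $I_0$, $I_S$ and $\mathcal{L}$ be as defined in the context. Then for every $S\in\mathcal{L}$ the (Krull) dimension of $R/I_S$ is $\ell(k+d-1)-k$, and the (Krull) dimension of $R/I_0$ is $\ell(k+d)-d-1$.
   Context: Let $K$ be a field and $2\le k\le\ell\le d$ integers. Let $P=(p_{x,y})_{x\in[d],\,y\in[k\ell]}$ be a $d\times k\ell$ matrix of indeterminates and $R=K[P]$. For $A\subseteq[d]$, $B\subseteq[k\ell]$ with $|A|=|B|$, $[A|B]$ denotes the determinant of the submatrix of $P$ with rows indexed by $A$ and columns indexed by $B$ (in increasing order). Arrange $[k\ell]$ in a $k\times\ell$ matrix $\mathcal{Y}$ with entries $\mathcal{Y}_{i,j}=(j-1)k+i$ for $i\in[k]$, $j\in[\ell]$, and put $C_j=\{\mathcal{Y}_{i,j}: i\in[k]\}$ for $j\in[\ell]$. Ideals of $R$: - $I_0=\langle [A|B] : A\subseteq[d],\ B\subseteq C_j \text{ for some } j\in[\ell],\ |A|=|B|=2\rangle+\langle [A|B]: A\subseteq[d],\ B\subseteq[k\ell],\ |A|=|B|=\ell\rangle$. - For $S\subseteq[k\ell]$: $I_S=\langle p_{i,j}: i\in[d],\ j\in S\rangle+\langle [A|B] : A\subseteq[d],\ B\subseteq C_j \text{ for some } j\in[\ell],\ |A|=|B|=2\rangle$. $\mathcal{L}=\big\{\{\mathcal{Y}_{i_1,j_1},\dots,\mathcal{Y}_{i_k,j_k}\} : |\{i_1,\dots,i_k\}|=k,\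 |\{j_1,\dots,j_k\}|\ge 2\big\}$. *)

(* Defs.v *)
From HB Require Import structures.
From mathcomp Require Import all_boot all_order all_algebra.
From mathcomp Require Import ring_quotient.
From mathcomp.multinomials Require Import mpoly.

Set Implicit Arguments.
Unset Strict Implicit.
Unset Printing Implicit Defensive.

Import GRing.Theory.
Local Open Scope ring_scope.

Section Ideals.
Variable A : comNzRingType.

Definition ideal_gen (G : A -> Prop) (f : A) : Prop :=
  exists s : seq (A * A),
    (forall c, c \in s -> G c.2) /\ f = \sum_(c <- s) c.1 * c.2.

Definition ideal_add (I J : A -> Prop) (f : A) : Prop :=
  exists g h, [/\ I g, J h & f = g + h].

(* [prime_idealr A] is the type of proper prime ideals; being given by boolean
   predicates is no restriction in the presence of classical logic. *)
Definition prime_chain (n : nat) (p : 'I_n.+1 -> prime_idealr A) : Prop :=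
  forall i j : 'I_n.+1, (i < j)%N ->
    {subset p i <= p j} /\ ~ {subset p j <= p i}.

Definition has_krull_dim (n : nat) : Prop :=
  (exists p : 'I_n.+1 -> prime_idealr A, prime_chain p) /\
  (forall m (p : 'I_m.+1 -> prime_idealr A), prime_chain p -> (m <= n)%N).

End Ideals.

(* [{ideal_quot J}] is only available for a bundled proper ideal [J] given by
   a boolean predicate. An improper [I] gives the zero ring, whose dimension is
   not a natural number, so the existential loses nothing. *)
Definition quot_has_krull_dim (A : comNzRingType) (I : A -> Prop) (n : nat) :
    Prop :=
  exists J : idealr A,
    (forall f, f \in J <-> I f) /\ has_krull_dim {ideal_quot J} n.

Section Determinantal.
Variables (K : fieldType) (d k l : nat).

(* [mxvec_index] is the bijection between pairs [(x, y)] and ['I_(d * (k * l))]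
   which lets [{mpoly K[d * (k * l)]}] be the ring in the entries of a matrix
   of indeterminates. *)
Definition R := {mpoly K[d * (k * l)]}.

Definition P : 'M[R]_(d, k * l) := \matrix_(x, y) 'X_(mxvec_index x y).

(* [enum_val] enumerates a set of ordinals in increasing order. *)
Definition minor (A : {set 'I_d}) (B : {set 'I_(k * l)}) (eqAB : #|A| = #|B|) :
    R :=
  \det (\matrix_(i < #|A|, j < #|A|)
          P (enum_val i) (enum_val (cast_ord eqAB j))).

Lemma Y_subproof (i : 'I_k) (j : 'I_l) : (j * k + i < k * l)%N.
Proof.
apply: (@leq_trans (j.+1 * k)); first by rewrite mulSn addnC ltn_add2r.
by rewrite mulnC leq_mul2l ltn_ord orbT.
Qed.

(* Zero-based version of the entry (j - 1) k + i for 1 <= i <= k, 1 <= j <= l. *)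
Definition Y (i : 'I_k) (j : 'I_l) : 'I_(k * l) := Ordinal (Y_subproof i j).

Definition C (j : 'I_l) : {set 'I_(k * l)} := [set Y i j | i : 'I_k].

Definition minors (r : nat) (f : R) : Prop :=
  exists (A : {set 'I_d}) (B : {set 'I_(k * l)}) (eqAB : #|A| = #|B|),
    #|A| = r /\ f = minor eqAB.

Definition column_minors (r : nat) (f : R) : Prop :=
  exists (A : {set 'I_d}) (B : {set 'I_(k * l)}) (eqAB : #|A| = #|B|),
    [/\ exists j, B \subset C j, #|A| = r & f = minor eqAB].

Definition ideal_0 : R -> Prop :=
  ideal_add (ideal_gen (column_minors 2)) (ideal_gen (minors l)).

Definition variables (S : {set 'I_(k * l)}) (f : R) : Prop :=
  exists i j, j \in S /\ f = P i j.

Definition ideal_S (S : {set 'I_(k * l)}) : R -> Prop :=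
  ideal_add (ideal_gen (variables S)) (ideal_gen (column_minors 2)).

Definition calL (S : {set 'I_(k * l)}) : Prop :=
  exists (i : 'I_k -> 'I_k) (j : 'I_k -> 'I_l),
    [/\ #|[set i t | t : 'I_k]| = k, (2 <= #|[set j t | t : 'I_k]|)%N
      & S = [set Y (i t) (j t) | t : 'I_k]].

End Determinantal.

(* Main.v *)
Require Import Defs.
From HB Require Import structures.
From mathcomp Require Import all_boot all_order all_algebra.
From mathcomp Require Import perm ring_quotient fraction zify.
From mathcomp.multinomials Require Import mpoly.
From Stdlib Require Import Classical ClassicalEpsilon.

(** A matrix annihilated by the 2-minors of the blocks C_j has blocks of rank at
    most one, so the block j is the product of a direction u_j in d-space and a
    row of k weights, and such a block has d + k - 1 degrees of freedom.
    - For I_S the columns in S vanish.  These are k columns, and no block loses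
      all its columns, so the dimension is l (d + k - 1) - k.
    - For I_0 the l directions u_j are moreover linearly dependent.  One of them
      is a combination of the others, which replaces its d coordinates by l - 1
      coefficients: l (d + k - 1) - d + (l - 1) = l (k + d) - d - 1.  The points
      with a vanishing block are covered as well, the direction of that block
      being the combination with zero coefficients.

    Both inequalities are proved by elementary means.

    Upper bound.  A chain of m + 1 primes, with elements x_i in p_i but not in
    p_(i-1), makes x_1, ..., x_m algebraically independent modulo p_0
    ([chain_independent]).  The fraction field F of the residue ring of p_0 is a
    point of the variety with values in F.  Choosing a pivot in each nonzero
    block, one reads off from the description above n elements of F of which all
    entries are rational functions ([rational_from_pivots]), and counting
    monomials shows that more than n rational functions of n elements are
    algebraically dependent ([rational_dependent]), so m <= n.

    Lower bound.  The parametrization by directions, weights and coefficients is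
    an endomorphism of the polynomial ring that uses only n of the variables as
    parameters, one for each element of the set [cross].  Specializing these to
    zero one after another gives morphisms whose kernels are prime and increase.
    The order of specialization is such that each step kills the image of some
    variable p_(x,y) that was nonzero before, so all n inclusions are strict
    ([specialization_chain]). *)

Set Implicit Arguments.
Unset Strict Implicit.
Unset Printing Implicit Defensive.

(** * Ring morphisms out of polynomial rings *)

Section PolynomialMorphisms.
Import GRing.Theory.
Local Open Scope ring_scope.

Lemma mmap_var (n : nat) (A B : nzRingType) (f : {rmorphism A -> B})
    (h : 'I_n -> B) i : mmap f h 'X_i = h i.
Proof. by rewrite mmapX mmap1U. Qed.

Lemma rmorph_mpolyE (n : nat) (A : comNzRingType) (B : comNzRingType)
    (f : {rmorphism {mpoly A[n]} -> B}) (p : {mpoly A[n]}) :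
  f p = mmap (f \o @mpolyC n A) (fun i => f 'X_i) p.
Proof.
rewrite {1}(mpolyE p) rmorph_sum; apply: eq_bigr => m _.
rewrite -mul_mpolyC rmorphM mpolyXE_id rmorph_prod; congr (_ * _).
by apply: eq_bigr => i _; rewrite rmorphXn.
Qed.

Lemma eq_rmorph_mpoly (n : nat) (A B : comNzRingType)
    (f g : {rmorphism {mpoly A[n]} -> B}) :
  (forall c, f c%:MP = g c%:MP) -> (forall i, f 'X_i = g 'X_i) -> f =1 g.
Proof.
move=> eqC eqX p; rewrite (rmorph_mpolyE f) (rmorph_mpolyE g).
apply: eq_bigr => m _ /=.
by rewrite eqC; congr (_ * _); apply: eq_bigr => i _; rewrite eqX.
Qed.

Lemma rmorph_mmap (n : nat) (A B B' : comNzRingType) (g : {rmorphism B -> B'})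
    (f : {rmorphism A -> B}) (h : 'I_n -> B) (p : {mpoly A[n]}) :
  g (mmap f h p) = mmap (g \o f) (g \o h) p.
Proof.
rewrite rmorph_sum; apply: eq_bigr => m _; rewrite rmorphM rmorph_prod.
by congr (_ * _); apply: eq_bigr => i _; rewrite rmorphXn.
Qed.

Lemma eq_mmap (n : nat) (A B : nzRingType) (f g : A -> B) (h h' : 'I_n -> B) :
  f =1 g -> h =1 h' -> mmap f h =1 mmap g h'.
Proof.
move=> eqf eqh p; apply: eq_bigr => m _; rewrite eqf; congr (_ * _).
by apply: eq_bigr => i _; rewrite eqh.
Qed.

End PolynomialMorphisms.

(** * Algebraic dependence by counting monomials *)

Section AlgebraicDependence.
Import GRing.Theory.
Local Open Scope ring_scope.
Variables (K F : fieldType) (iota : {rmorphism K -> F}).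

Lemma kernel_row (m n : nat) (M : 'M[K]_(m, n)) :
  (n < m)%N -> exists2 v : 'rV_m, v != 0 & v *m M = 0.
Proof.
move=> lt_nm; have : kermx M != 0.
  rewrite -mxrank_eq0 mxrank_ker subn_eq0 -ltnNge.
  exact: leq_ltn_trans (rank_leq_col M) lt_nm.
by case/rowV0Pn=> v /sub_kermxP vM nz_v; exists v.
Qed.

Lemma msize_prod_le (n : nat) (I : finType) (G : I -> {mpoly K[n]}) (e : nat) :
  (forall i, msize (G i) <= e.+1)%N -> (msize (\prod_i G i) <= (#|I| * e).+1)%N.
Proof.
move=> leG; rewrite cardE -big_enum /=; elim: (enum I) => [|i s IHs].
  by rewrite big_nil msize1.
rewrite big_cons; have [->|nzG] := eqVneq (G i) 0; first by rewrite mul0r msize0.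
have [->|nzp] := eqVneq (\prod_(j <- s) G j) 0; first by rewrite mulr0 msize0.
rewrite msizeM //= mulSn; have := leq_add (leG i) IHs.
by rewrite addSn addnS; case: (_ + _)%N => // u; rewrite /= ltnS.
Qed.

Lemma msize_exp_le (n : nat) (p : {mpoly K[n]}) (D e : nat) :
  (msize p <= D.+1)%N -> (msize (p ^+ e) <= (e * D).+1)%N.
Proof.
move=> lep; have := @msize_prod_le n 'I_e (fun=> p) D (fun=> lep).
by rewrite prodr_const cardE size_enum_ord.
Qed.

(** Polynomials in n variables of degree less than N lie in the span of the
    N ^ n monomials with all exponents less than N. *)
Lemma many_polys_dependent (n N : nat) (I : finType) (G : I -> {mpoly K[n]}) :
  (forall i, msize (G i) <= N)%N -> (N ^ n < #|I|)%N ->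
  exists2 c : I -> K, (exists i, c i != 0) & \sum_i c i *: G i = 0.
Proof.
move=> leG lt_I.
pose mon (g : {ffun 'I_n -> 'I_N}) := [multinom (g i : nat) | i < n].
pose M := \matrix_(i < #|I|, g < #|{ffun 'I_n -> 'I_N}|)
            (G (enum_val i))@_(mon (enum_val g)).
have [|v nz_v vM] := @kernel_row _ _ M; first by rewrite card_ffun !card_ord.
exists (fun i => v 0 (enum_rank i)).
  have /rV0Pn[i nz_vi] := nz_v.
  by exists (enum_val i); rewrite enum_valK.
apply/mpolyP=> m; rewrite mcoeff0 raddf_sum /=.
have [ltm|] := boolP [forall i, (m i < N)%N].
  have lt_m i := forallP ltm i.
  pose g := [ffun i => Ordinal (lt_m i)].
  have mE : mon g = m by apply/mnmP=> i; rewrite mnmE ffunE.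
  transitivity ((v *m M) 0 (enum_rank g)); last by rewrite vM mxE.
  rewrite mxE (reindex (@enum_val I predT)) /=; last first.
    by apply: onW_bij; apply: enum_val_bij.
  by apply: eq_bigr => i _; rewrite mcoeffZ enum_valK mxE enum_rankK mE.
rewrite negb_forall => /existsP[i]; rewrite -leqNgt => leNm.
rewrite big1 // => j _; rewrite mcoeffZ memN_msupp_eq0 ?mulr0 //.
apply: msize_mdeg_ge; apply: leq_trans (leG j) (leq_trans leNm _).
by rewrite mdegE (bigD1 i) //= leq_addr.
Qed.

Variables (n : nat) (t : 'I_n -> F).

(** Membership in the subfield generated by [t] over the image of [iota],
    phrased with numerators and denominators because [t] may be algebraically
    dependent. *)
Definition rational_in (x : F) : Prop :=
  exists a b, mmap iota t b != 0 /\ x * mmap iota t b = mmap iota t a.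

Lemma rational_const c : rational_in (iota c).
Proof. by exists c%:MP, 1; rewrite rmorph1 oner_eq0 mulr1 mmapC. Qed.

Lemma rational_gen i : rational_in (t i).
Proof. by exists 'X_i, 1; rewrite rmorph1 oner_eq0 mulr1 mmap_var. Qed.

Lemma rational0 : rational_in 0.
Proof. by rewrite -(rmorph0 iota); apply: rational_const. Qed.

Lemma rational1 : rational_in 1.
Proof. by rewrite -(rmorph1 iota); apply: rational_const. Qed.

Lemma rationalD x y : rational_in x -> rational_in y -> rational_in (x + y).
Proof.
move=> [a [b [nzb xb]]] [a' [b' [nzb' yb']]].
exists (a * b' + a' * b), (b * b'); rewrite rmorphD !rmorphM mulf_neq0 //.
split=> //=; rewrite -xb -yb' mulrDl -!mulrA; congr (_ + y * _).
by rewrite mulrC.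
Qed.

Lemma rationalM x y : rational_in x -> rational_in y -> rational_in (x * y).
Proof.
move=> [a [b [nzb xb]]] [a' [b' [nzb' yb']]].
exists (a * a'), (b * b'); rewrite !rmorphM mulf_neq0 //; split=> //=.
by rewrite -xb -yb' mulrACA.
Qed.

Lemma rationalV x : rational_in x -> rational_in x^-1.
Proof.
have [->|nzx] := eqVneq x 0; first by rewrite invr0.
move=> [a [b [nzb xb]]]; exists b, a; rewrite -xb mulf_neq0 //; split=> //.
by rewrite mulKf.
Qed.

Lemma rational_sum (I : Type) (s : seq I) (Q : pred I) (G : I -> F) :
  (forall i, Q i -> rational_in (G i)) -> rational_in (\sum_(i <- s | Q i) G i).
Proof.
by move=> ratG; elim/big_ind: _ => //; [exact: rational0 | exact: rationalD].
Qed.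

Lemma rational_mmap (m : nat) (h : 'I_m -> F) p :
  (forall i, rational_in (h i)) -> rational_in (mmap iota h p).
Proof.
move=> rath; apply: rational_sum => u _; apply: rationalM.
  exact: rational_const.
rewrite /mmap1; elim/big_ind: _ => [|x y|i _].
- exact: rational1.
- exact: rationalM.
elim: (u i) => [|e IHe]; rewrite ?expr0 ?exprS; first exact: rational1.
exact: rationalM.
Qed.

Lemma common_denominator (m : nat) (y : 'I_m -> F) :
  (forall i, rational_in (y i)) ->
  exists a b, mmap iota t b != 0 /\
    forall i : 'I_m, y i * mmap iota t b = mmap iota t (a i).
Proof.
move=> /fin_all_exists[a /fin_all_exists[b ab]].
exists (fun i => a i * \prod_(j | j != i) b j), (\prod_j b j); split.
  rewrite rmorph_prod prodf_seq_neq0; apply/allP=> i _.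
  by have [->] := ab i.
by move=> i; rewrite (bigD1 i) //= !rmorphM mulrA; have [_ ->] := ab i.
Qed.

(** More than n rational functions of n elements are algebraically dependent.
    Over a common denominator b the products of powers of the m functions with
    all exponents below N, multiplied by a fixed power of b, are polynomials in
    [t] of degree at most N times a constant, so they span a space of dimension
    O(N ^ n).  There are N ^ m of them, which is more once N is large. *)
Lemma rational_dependent (m : nat) (y : 'I_m -> F) :
  (forall i, rational_in (y i)) -> (n < m)%N ->
  exists2 G : {mpoly K[m]}, G != 0 & mmap iota y G = 0.
Proof.
move=> /common_denominator[a [b [nzb ab]]] lt_nm.
(* N is chosen so that N ^ m >= N ^ n * N exceeds (N * (m * (D + 1))) ^ n. *)
pose D := maxn (msize b) (\max_i msize (a i)).
pose N := ((m * D.+1) ^ n).+1.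
pose G (e : {ffun 'I_m -> 'I_N}) := \prod_i (a i ^+ e i * b ^+ (N - e i)).
have leG e : (msize (G e) <= N * (m * D.+1))%N.
  have le_i i : (msize (a i ^+ e i * b ^+ (N - e i)) <= (N * D).+1)%N.
    have le_e : (e i <= N)%N by apply: ltnW.
    have [->|nza] := eqVneq (a i ^+ e i) 0; first by rewrite mul0r msize0.
    have [->|nzbe] := eqVneq (b ^+ (N - e i)) 0; first by rewrite mulr0 msize0.
    rewrite msizeM //.
    have lea : (msize (a i ^+ e i) <= (e i * D).+1)%N.
      by apply: msize_exp_le; rewrite leqW // leq_max leq_bigmax orbT.
    have leb : (msize (b ^+ (N - e i)) <= ((N - e i) * D).+1)%N.
      by apply: msize_exp_le; rewrite leqW // leq_max leqnn.
    have := leq_add lea leb.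
    rewrite addSn addnS -mulnDl subnKC //.
    by case: (_ + _)%N => // u; rewrite ltnS.
  apply: leq_trans (msize_prod_le le_i) _; rewrite card_ord.
  rewrite mulnCA mulnS mulnDr.
  by rewrite -addn1 addnC leq_add2r muln_gt0 (leq_ltn_trans _ lt_nm).
have [|c [e0 nz_c] sum_c] := many_polys_dependent leG.
  rewrite card_ffun !card_ord expnMn.
  apply: (@leq_trans (N ^ n * N)); first by rewrite ltn_pmul2l ?expn_gt0.
  by rewrite -expnSr leq_pexp2l.
pose mon (e : {ffun 'I_m -> 'I_N}) := [multinom (e i : nat) | i < m].
have mon_inj : injective mon.
  move=> e e' eq_e; apply/ffunP=> i; apply: val_inj.
  by have /mnmP/(_ i) := eq_e; rewrite !mnmE.
exists (\sum_e c e *: 'X_[mon e]).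
  apply: contra nz_c => /eqP/mpolyP/(_ (mon e0)).
  rewrite mcoeff0 raddf_sum (bigD1 e0) //= mcoeffZ mcoeffX eqxx mulr1.
  rewrite big1 ?addr0 => [-> //|e ne_e].
  by rewrite mcoeffZ mcoeffX (inj_eq mon_inj) (negPf ne_e) mulr0.
(* The linear relation is homogenized by b; dividing by b ^ (m * N) gives the
   polynomial relation between the fractions. *)
apply: (mulIf (expf_neq0 (m * N) nzb)); rewrite mul0r.
have := congr1 (mmap iota t) sum_c; rewrite mmap0 => <-.
rewrite !rmorph_sum mulr_suml; apply: eq_bigr => e _ /=.
rewrite !mmapZ -mulrA; congr (_ * _).
rewrite mmapX rmorph_prod -[m in (m * N)%N]card_ord mulnC exprM -prodr_const.
rewrite -big_split; apply: eq_bigr => i _ /=.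
rewrite mnmE rmorphM !rmorphXn /= -ab exprMn -!mulrA -exprD subnKC //.
exact: ltnW.
Qed.

End AlgebraicDependence.

(** * Primes as kernels, and chains of primes *)

Section ResidueField.
Import GRing.Theory.
Local Open Scope ring_scope.
Local Open Scope quotient_scope.
Variables (A : comNzRingType) (p : prime_idealr A).

(** A separate name for the quotient, carrying the inverses that are needed to
    form the field of fractions; deciding invertibility uses classical logic. *)
Definition residue_domain := {ideal_quot p}.

HB.instance Definition _ := GRing.ComNzRing.on residue_domain.

Let invertible (x : residue_domain) : bool :=
  if excluded_middle_informative (exists y, y * x == 1) then true else false.

Let inverse (x : residue_domain) : residue_domain :=
  if excluded_middle_informative (exists y, y * x == 1) is left xV
  then xchoose xV else x.

Let inverse_mull : {in invertible, left_inverse 1 inverse *%R}.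
Proof.
move=> x; rewrite unfold_in /invertible /inverse.
by case: excluded_middle_informative => // xV _; apply/eqP/(xchooseP xV).
Qed.

Let invertible_intro x y : y * x = 1 -> invertible x.
Proof.
rewrite /invertible => yx1; case: excluded_middle_informative => // nxV.
by case: nxV; exists y; apply/eqP.
Qed.

Let inverse_out : {in [predC invertible], inverse =1 id}.
Proof.
move=> x; rewrite inE /= unfold_in /invertible /inverse.
by case: excluded_middle_informative.
Qed.

HB.instance Definition _ := GRing.ComNzRing_hasMulInverse.Build residue_domain
  inverse_mull invertible_intro inverse_out.

Let residue_integral : GRing.integral_domain_axiom residue_domain.
Proof. exact: Quotient.rquot_IdomainAxiom. Qed.

HB.instance Definition _ :=
  GRing.ComUnitRing_isIntegral.Build residue_domain residue_integral.

Lemma prime_is_kernel :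
  exists (F : fieldType) (phi : {rmorphism A -> F}),
    forall a, (phi a == 0) = (a \in p).
Proof.
pose pi : {rmorphism A -> residue_domain} := \pi_({ideal_quot p}).
exists {fraction residue_domain}.
exists (@FracField.tofrac residue_domain \o pi) => a /=.
rewrite tofrac_eq0 -[a in RHS]subr0 Quotient.idealrBE.
by rewrite -[RHS]/(pi a == pi 0) rmorph0.
Qed.

End ResidueField.

Section Chains.
Import GRing.Theory.
Local Open Scope ring_scope.
Variables (K : fieldType).

Lemma muni_lift (n : nat) (i : 'I_n) :
  muni ('X_(lift ord_max i) : {mpoly K[n.+1]}) = ('X_i)%:P.
Proof.
rewrite muniE msuppX big_seq1 mcoeffX eqxx scale1r mnm1E.
rewrite eq_sym (negPf (neq_lift _ _)) expr0 -mul_polyC mulr1.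
congr ('X_[_])%:P; apply/mnmP=> j; rewrite mnmE !mnm1E -!val_eqE /=.
by rewrite /bump leqNgt ltn_ord.
Qed.

Lemma muni_last (n : nat) : muni ('X_ord_max : {mpoly K[n.+1]}) = 'X.
Proof.
rewrite muniE msuppX big_seq1 mcoeffX eqxx scale1r mnm1E eqxx expr1.
rewrite -[RHS]scale1r -mpolyX0; congr (_ *: _); congr 'X_[_].
apply/mnmP=> j; rewrite mnmE mnm1E mnm0E -val_eqE /=.
by rewrite gtn_eqF.
Qed.

Lemma muni_inj (n : nat) (F : {mpoly K[n.+1]}) : muni F = 0 -> F = 0.
Proof.
pose h : 'I_n -> {mpoly K[n.+1]} := fun i => 'X_(lift ord_max i).
pose g : {rmorphism {poly {mpoly K[n]}} -> {mpoly K[n.+1]}} :=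
  horner_eval ('X_ord_max : {mpoly K[n.+1]}) \o map_poly (mmap (@mpolyC _ K) h).
have gK : g \o @muni n K =1 idfun.
  apply: (@eq_rmorph_mpoly _ _ _ (g \o @muni n K) idfun) => [c|i] /=.
    by rewrite muniC map_polyC /horner_eval hornerC /= mmapC.
  rewrite /horner_eval; case: (unliftP ord_max i) => [j ->|->].
    by rewrite muni_lift map_polyC hornerC /= mmap_var.
  by rewrite muni_last map_polyX hornerX.
move=> F0; rewrite -[LHS]/(idfun F) -gK -[LHS]/(g (muni F)) F0; exact: rmorph0.
Qed.

Lemma mmap_muni (A : comNzRingType) (iota : {rmorphism K -> A}) (n : nat)
    (x : 'I_n.+1 -> A) (F : {mpoly K[n.+1]}) :
  mmap iota x F =
    (map_poly (mmap iota (fun i => x (lift ord_max i))) (muni F)).[x ord_max].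
Proof.
pose g : {rmorphism {poly {mpoly K[n]}} -> A} :=
  horner_eval (x ord_max)
    \o map_poly (mmap iota (fun i => x (lift ord_max i))).
apply: (@eq_rmorph_mpoly _ _ _ (mmap iota x) (g \o @muni n K)) => [c|i] /=.
  by rewrite mmapC muniC map_polyC /horner_eval hornerC /= mmapC.
rewrite mmap_var /horner_eval; case: (unliftP ord_max i) => [j ->|->].
  by rewrite muni_lift map_polyC hornerC /= mmap_var.
by rewrite muni_last map_polyX hornerX.
Qed.

Definition independent_mod (A : comNzRingType) (iota : {rmorphism K -> A})
    (p : {pred A}) (n : nat) (x : 'I_n -> A) : Prop :=
  forall F : {mpoly K[n]}, mmap iota x F \in p -> F = 0.

(** Prepending a prime to a chain gains one independent element [y].  Write a
    relation modulo [p] as G(y) * y + c with c free of [y].  As [y] vanishes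
    modulo [q], so does c, which is therefore zero; then [y], being nonzero
    modulo the prime [p], cancels and G is a relation of smaller degree. *)
Lemma independent_step (A : comNzRingType) (iota : {rmorphism K -> A})
    (p q : prime_idealr A) (n : nat) (x : 'I_n.+1 -> A) :
  {subset p <= q} -> x ord_max \in q -> x ord_max \notin p ->
  independent_mod iota q (fun i => x (lift ord_max i)) ->
  independent_mod iota p x.
Proof.
move=> spq xq xNp indep F; rewrite mmap_muni => Fp; apply: muni_inj.
set y := x ord_max in xq xNp Fp.
elim/poly_ind: (muni F) Fp => // G c IHG.
rewrite rmorphD rmorphM /= map_polyX map_polyC hornerMXaddC => Gp.
have c0 : c = 0.
  apply: indep; have := spq _ Gp; rewrite rpredDl //.
  by rewrite idealMr.
move: Gp; rewrite c0 raddf0 !addr0 => Gp.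
have /orP[/IHG->|] := prime_idealr_closed_subproof _ _ Gp.
  by rewrite mul0r.
by rewrite (negPf xNp).
Qed.

(** The new element of each step is stored last, because univariate polynomials
    over polynomials in n variables single out the last variable. *)
Lemma chain_independent (A : comNzRingType) (iota : {rmorphism K -> A}) (n : nat)
    (p : 'I_n.+1 -> prime_idealr A) :
  prime_chain p -> exists x : 'I_n -> A, independent_mod iota (p ord0) x.
Proof.
elim: n p => [|n IHn] p chp.
  exists (fun=> 0) => F; rewrite [F]nvar0_mpolyC mmapC.
  set c := F@__; have [-> //|nzc] := eqVneq c 0.
  move=> /(idealMr (iota c^-1)); rewrite -rmorphM mulVf // rmorph1.
  by rewrite idealr1.
have [|x indep] := IHn (fun i => p (lift ord0 i)).
  by move=> i j lt_ij; apply: chp; rewrite !lift0.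
have [sub01 nsub10] := chp ord0 (lift ord0 ord0) isT.
have [y yp1 yNp0] : exists2 y, y \in p (lift ord0 ord0) & y \notin p ord0.
  apply: NNPP => no_y; apply: nsub10 => y yp1.
  by have [//|yNp0] := boolP (y \in p ord0); case: no_y; exists y.
exists (fun i => if unlift ord_max i is Some j then x j else y).
apply: (independent_step sub01); rewrite ?unlift_none //.
move=> F; rewrite (@eq_mmap _ _ _ iota iota _ x) => [/indep|//|i] //.
by rewrite liftK.
Qed.

End Chains.

(** * Quotients of a polynomial ring and their dimension *)

Section Ideals.
Import GRing.Theory.
Local Open Scope ring_scope.
Local Open Scope quotient_scope.
Variables (A : comNzRingType).

Lemma kernel_prime (D : idomainType) (psi : {rmorphism A -> D}) :
  exists p : prime_idealr A, forall a, (a \in p) = (psi a == 0).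
Proof.
pose ker : A -> bool := fun a => psi a == 0.
have kerP : idealr_closed ker.
  split; rewrite ?unfold_in /ker ?rmorph0 ?rmorph1 ?oner_eq0 //.
  move=> a u w; rewrite !unfold_in => /eqP u0 /eqP w0.
  by rewrite rmorphD rmorphM u0 w0 mulr0 addr0.
have prime_ker : prime_idealr_closed ker.
  by move=> u w; rewrite !unfold_in /ker rmorphM mulf_eq0.
pose ideal_mixin := isIdealr.Build A ker kerP.
pose prime_mixin := isPrimeIdealrClosed.Build A ker prime_ker.
pose ker_ideal : idealr A := HB.pack_for (idealr A) ker ideal_mixin.
pose ker_prime : prime_idealr A :=
  HB.pack_for (prime_idealr A) ker ker_ideal prime_mixin.
by exists ker_prime => a.
Qed.

Lemma quotient_morphism (B : comNzRingType) (J : idealr A)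
    (phi : {rmorphism A -> B}) :
  {in J, forall f, phi f = 0} ->
  exists psi : {rmorphism {ideal_quot J} -> B},
    forall f, psi (\pi_({ideal_quot J}) f) = phi f.
Proof.
move=> phiJ; pose psi (x : {ideal_quot J}) := phi (repr x).
have psiE f : psi (\pi_({ideal_quot J}) f) = phi f.
  apply/eqP; rewrite -subr_eq0 -rmorphB; apply/eqP/phiJ.
  by rewrite Quotient.idealrBE reprK.
have psiB : zmod_morphism psi.
  move=> x y; rewrite -[x]reprK -[y]reprK.
  by rewrite -rmorphB !psiE rmorphB.
have psiM : monoid_morphism psi.
  split; first by rewrite -(rmorph1 \pi_({ideal_quot J})) psiE rmorph1.
  by move=> x y; rewrite -[x]reprK -[y]reprK -rmorphM !psiE rmorphM.
pose psi_add := GRing.isZmodMorphism.Build _ _ psi psiB.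
pose psi_mul := GRing.isMonoidMorphism.Build _ _ psi psiM.
by exists (HB.pack_for {rmorphism {ideal_quot J} -> B} psi psi_add psi_mul).
Qed.

Variables G H : A -> Prop.

Lemma ideal_gen_zero (B : comNzRingType) (phi : {rmorphism A -> B})
    (E : A -> Prop) f :
  (forall g, E g -> phi g = 0) -> ideal_gen E f -> phi f = 0.
Proof.
move=> phiE [s [Es ->]]; rewrite rmorph_sum big_seq big1 // => c cs.
by rewrite rmorphM (phiE c.2) ?mulr0 //; apply: Es.
Qed.

Lemma ideal_sum_zero (B : comNzRingType) (phi : {rmorphism A -> B}) f :
  (forall g, G g -> phi g = 0) -> (forall g, H g -> phi g = 0) ->
  ideal_add (ideal_gen G) (ideal_gen H) f -> phi f = 0.
Proof.
move=> phiG phiH [g [h [Ig Jh ->]]].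
by rewrite rmorphD (ideal_gen_zero phiG Ig) (ideal_gen_zero phiH Jh) addr0.
Qed.

Lemma ideal_gen_closed (E : A -> Prop) a u w :
  ideal_gen E u -> ideal_gen E w -> ideal_gen E (a * u + w).
Proof.
move=> [s [Es ->]] [s' [Es' ->]].
exists ([seq (a * c.1, c.2) | c <- s] ++ s'); split.
  by move=> c; rewrite mem_cat => /orP[/mapP[c' /Es Ec' ->] | /Es'].
rewrite big_cat big_map mulr_sumr; congr (_ + _).
by apply: eq_bigr => c _; rewrite mulrA.
Qed.

(** Any morphism into a nonzero ring that kills the generators shows that the
    ideal is proper. *)
Lemma proper_ideal_sum (B : comNzRingType) (phi : {rmorphism A -> B}) :
  (forall g, G g -> phi g = 0) -> (forall g, H g -> phi g = 0) ->
  exists J : idealr A,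
    forall f, f \in J <-> ideal_add (ideal_gen G) (ideal_gen H) f.
Proof.
move=> phiG phiH.
pose I f := ideal_add (ideal_gen G) (ideal_gen H) f.
pose mem : A -> bool :=
  fun f => if excluded_middle_informative (I f) then true else false.
have memP f : f \in (mem : {pred A}) <-> I f.
  by rewrite unfold_in /mem; case: excluded_middle_informative.
have memC : idealr_closed mem.
  split.
  - have gen0 E : ideal_gen E (0 : A) by exists [::]; rewrite big_nil.
    by apply/memP; exists 0, 0; rewrite addr0; split; first 2 [exact: gen0].
  - apply/negP => /memP/(ideal_sum_zero phiG phiH)/eqP.
    by rewrite rmorph1 oner_eq0.
  - move=> a u w /memP[g [h [Gg Hh ->]]] /memP[g' [h' [Gg' Hh' ->]]].
    apply/memP; exists (a * g + g'), (a * h + h'); split.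
    + exact: ideal_gen_closed.
    + exact: ideal_gen_closed.
    + by rewrite mulrDr addrACA.
pose mem_ideal := isIdealr.Build A mem memC.
by exists (HB.pack_for (idealr A) mem mem_ideal).
Qed.

End Ideals.

Section Dimension.
Import GRing.Theory.
Local Open Scope ring_scope.
Local Open Scope quotient_scope.
Variables (K : fieldType) (v : nat).
Local Notation Rv := {mpoly K[v]}.

(** A chain of length m gives m elements that are independent modulo its smallest
    prime, hence in the fraction field F of the residue ring.  All of them are
    rational functions of the generators [t] of F, so m is at most their
    number. *)
Lemma chain_length_le (J : idealr Rv) (n : nat) :
  (forall (F : fieldType) (phi : {rmorphism Rv -> F}),
     {in J, forall f, phi f = 0} ->
     exists r (t : 'I_r -> F), (r <= n)%N /\
       forall i, rational_in (phi \o @mpolyC v K) t (phi 'X_i)) ->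
  forall m (p : 'I_m.+1 -> prime_idealr {ideal_quot J}),
    prime_chain p -> (m <= n)%N.
Proof.
move=> gens m p chp.
pose pi : {rmorphism Rv -> {ideal_quot J}} := \pi_({ideal_quot J}).
have [x indep] := chain_independent (pi \o @mpolyC v K) chp.
have [F [psi psiP]] := prime_is_kernel (p ord0).
have [|r [t [le_rn ratX]]] := gens F (psi \o pi).
  move=> f fJ /=; rewrite (_ : pi f = 0) ?rmorph0 //.
  apply/eqP; rewrite -(rmorph0 pi) -[_ == _]/(f == 0 %[mod {ideal_quot J}]).
  by rewrite -Quotient.idealrBE subr0.
rewrite leqNgt; apply/negP => lt_nm.
have ratx i : rational_in ((psi \o pi) \o @mpolyC v K) t ((psi \o x) i).
  rewrite /= -[x i]reprK -[psi _]/((psi \o pi) (repr (x i))) rmorph_mpolyE.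
  exact: rational_mmap.
have [P nzP P0] := rational_dependent ratx (leq_ltn_trans le_rn lt_nm).
case/eqP: nzP; apply: indep.
by rewrite -psiP rmorph_mmap; apply/eqP.
Qed.

(** Both halves of a dimension computation: the generic points of the closed
    subset cut out by G and H need at most n coordinates, and a strictly
    increasing sequence of kernels is a chain of primes of length n. *)
Lemma quot_krull_dim (G H : Rv -> Prop) (n : nat) (D : idomainType)
    (phi : 'I_n.+1 -> {rmorphism Rv -> D}) :
  (forall (F : fieldType) (psi : {rmorphism Rv -> F}),
     (forall g, G g -> psi g = 0) -> (forall g, H g -> psi g = 0) ->
     exists r (t : 'I_r -> F), (r <= n)%N /\
       forall i, rational_in (psi \o @mpolyC v K) t (psi 'X_i)) ->
  (forall i g, G g -> phi i g = 0) -> (forall i g, H g -> phi i g = 0) ->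
  (forall i j : 'I_n.+1, (i < j)%N ->
     (forall f, phi i f = 0 -> phi j f = 0) /\
     exists f, phi j f = 0 /\ phi i f != 0) ->
  quot_has_krull_dim (ideal_add (ideal_gen G) (ideal_gen H)) n.
Proof.
move=> upper phiG phiH chain.
have [J memJ] := proper_ideal_sum (phiG ord0) (phiH ord0).
exists J; split=> //; split; last first.
  apply: chain_length_le => F psi psiJ; apply: upper => g Eg.
    apply/psiJ/memJ; exists g, 0; rewrite addr0; split=> //.
      exists [:: (1, g)]; rewrite big_seq1 mul1r; split=> // c.
      by rewrite inE => /eqP->.
    by exists [::]; rewrite big_nil.
  apply/psiJ/memJ; exists 0, g; rewrite add0r; split=> //.
    by exists [::]; rewrite big_nil.
  exists [:: (1, g)]; rewrite big_seq1 mul1r; split=> // c.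
  by rewrite inE => /eqP->.
have /fin_all_exists[p pE] i : exists p : prime_idealr {ideal_quot J},
    forall f, (\pi_({ideal_quot J}) f \in p) = (phi i f == 0).
  have [|psi psiE] := @quotient_morphism _ _ J (phi i).
    by move=> f /memJ/(ideal_sum_zero (phiG i) (phiH i)).
  have [p pE] := kernel_prime psi.
  by exists p => f; rewrite pE psiE.
exists p => i j /chain[sub_ij [f [fj0 nzfi]]]; split.
  by move=> x; rewrite -[x]reprK !pE => /eqP/sub_ij->.
move/(_ (\pi_({ideal_quot J}) f)); rewrite !pE fj0 eqxx => /(_ isT).
exact/negP.
Qed.

End Dimension.

(** * Determinants of matrices of small rank *)

Section Determinants.
Import GRing.Theory.
Local Open Scope ring_scope.

Lemma det_size2 (B : comNzRingType) (M : 'M[B]_2) :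
  \det M = M 0 0 * M 1 1 - M 0 1 * M 1 0.
Proof.
rewrite (expand_det_row _ 0) !big_ord_recl big_ord0 addr0 /cofactor !det_mx11.
rewrite !mxE /= expr0 expr1 mul1r mulN1r mulrN.
by congr (M _ _ * M _ _ - M _ _ * M _ _); apply: val_inj.
Qed.

Lemma det_outer_product (B : comNzRingType) (n : nat) (M : 'M[B]_n)
    (u w : 'I_n -> B) :
  n = 2%N -> (forall i j, M i j = u i * w j) -> \det M = 0.
Proof.
move=> n2; move: M u w; rewrite n2 => M u w ME.
by rewrite det_size2 !ME mulrACA [w 0 * _]mulrC mulrACA subrr.
Qed.

Lemma det_factor_dependent (B : idomainType) (n l : nat) (M : 'M[B]_n)
    (u : 'I_n -> 'I_l -> B) (w : 'I_l -> 'I_n -> B) (c : 'I_l -> B) :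
  n = l -> (forall i j, M i j = \sum_h u i h * w h j) ->
  (exists h, c h != 0) -> (forall i, \sum_h c h * u i h = 0) -> \det M = 0.
Proof.
move=> nl; move: u w c; rewrite -nl => u w c ME [h nzc] cu0.
have -> : M = \matrix_(i, j) u i j *m \matrix_(i, j) w i j.
  by apply/matrixP=> i j; rewrite ME !mxE; apply: eq_bigr => a _; rewrite !mxE.
rewrite det_mulmx; suff -> : \det (\matrix_(i, j) u i j) = 0 by rewrite mul0r.
rewrite -det_tr; apply/eqP/det0P; exists (\row_j c j).
  by apply/rV0Pn; exists h; rewrite mxE.
apply/rowP=> i; rewrite !mxE -[RHS](cu0 i).
by apply: eq_bigr => j _; rewrite !mxE.
Qed.

(** Up to a permutation of rows and columns, which changes the determinant by a
    sign, the minor taken along two injections is the minor of their images; hence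
    the former vanishes with the latter. *)
Lemma det_along_injections (B : comNzRingType) (m n r : nat) (M : 'M[B]_(m, n))
    (f : 'I_r -> 'I_m) (g : 'I_r -> 'I_n) :
  injective f -> injective g ->
  (forall eqAB : #|[set f i | i : 'I_r]| = #|[set g i | i : 'I_r]|,
     \det (\matrix_(i, j < #|[set f i | i : 'I_r]|)
             M (enum_val i) (enum_val (cast_ord eqAB j))) = 0) ->
  \det (\matrix_(i < r, j < r) M (f i) (g j)) = 0.
Proof.
move=> inj_f inj_g det0.
have cA : #|[set f i | i : 'I_r]| = r by rewrite card_imset // card_ord.
have cB : #|[set g i | i : 'I_r]| = r by rewrite card_imset // card_ord.
have {}det0 := det0 (etrans cA (esym cB)).
have im q (h : 'I_r -> 'I_q) i : h i \in [set h i | i : 'I_r].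
  exact: imset_f.
pose rank (q : nat) (h : 'I_r -> 'I_q) (ch : #|[set h i | i : 'I_r]| = r) i :=
  cast_ord ch (enum_rank_in (im q h i) (h i)).
have rankK q (h : 'I_r -> 'I_q) ch i :
    enum_val (cast_ord (esym ch) (rank q h ch i)) = h i.
  by rewrite cast_ordK enum_rankK_in ?imset_f.
have rank_inj q (h : 'I_r -> 'I_q) ch : injective h -> injective (rank q h ch).
  by move=> inj_h i j eq_ij; apply: inj_h; rewrite -(rankK q h ch) eq_ij rankK.
pose s := perm (rank_inj _ _ cA inj_f); pose t := perm (rank_inj _ _ cB inj_g).
pose N := \matrix_(i < r, j < r)
  M (enum_val (cast_ord (esym cA) i)) (enum_val (cast_ord (esym cB) j)).
(* The cardinals become variables, so that the casts between them and r can be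
   eliminated. *)
have N0 : \det N = 0.
  rewrite -[RHS]det0 /N; move: (etrans _ _) => eqAB; move: (cA) (cB) eqAB.
  move: #|_| (@enum_val _ _) => a ea; move: #|_| (@enum_val _ _) => b eb.
  move=> ar br ab; subst a; subst b; congr (\det _).
  by apply/matrixP=> i j; rewrite !mxE; congr (M (ea _) (eb _)); apply: val_inj.
have -> : \matrix_(i < r, j < r) M (f i) (g j) = row_perm s (col_perm t N).
  by apply/matrixP=> i j; rewrite !mxE !permE !rankK.
by rewrite row_permE col_permE !det_mulmx N0 mul0r mulr0.
Qed.

Lemma column_dependency (F : fieldType) (m n : nat) (M : 'M[F]_(m, n)) :
  (forall f : 'I_n -> 'I_m, injective f ->
     \det (\matrix_(i < n, j < n) M (f i) j) = 0) ->
  exists2 c : 'I_n -> F, (exists j, c j != 0) &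
    forall i, \sum_j c j * M i j = 0.
Proof.
move=> minors0.
have [full|nfull] := boolP (row_full M).
  have := fullrowsub_unit full; rewrite unitmxE unitfE => /negP[].
  by apply/eqP; apply: minors0 => //; apply: fullrankfun_inj.
have : kermx M^T != 0.
  rewrite kermx_eq0 -row_leq_rank mxrank_tr -ltnNge ltn_neqAle rank_leq_col.
  by rewrite andbT.
case/rowV0Pn=> v /sub_kermxP vM /rV0Pn[j nzvj].
exists (fun j => v 0 j); first by exists j.
move=> i; transitivity ((v *m M^T) 0 i); last by rewrite vM mxE.
by rewrite mxE; apply: eq_bigr => h _; rewrite mxE.
Qed.

End Determinants.

(** * Chains of primes obtained by specializing variables *)

Section Specialization.
Import GRing.Theory.
Local Open Scope ring_scope.
Variables (K : fieldType) (d e : nat).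
Local Notation Rv := {mpoly K[d * e]}.
Local Notation entry := ('I_d * 'I_e)%type.
Implicit Types (Z W : {set entry}) (w z : entry).

(** Evaluation of the matrix of indeterminates at [M]. *)
Definition subst (B : comNzRingType) (iota : {rmorphism K -> B})
    (M : 'M[B]_(d, e)) : {rmorphism Rv -> B} :=
  mmap iota (fun i => mxvec M 0 i).

Lemma subst_var (B : comNzRingType) (iota : {rmorphism K -> B})
    (M : 'M[B]_(d, e)) x y : subst iota M 'X_(mxvec_index x y) = M x y.
Proof. by rewrite -[RHS]mxvecE; apply: mmap_var. Qed.

Lemma subst_const (B : comNzRingType) (iota : {rmorphism K -> B})
    (M : 'M[B]_(d, e)) c : subst iota M c%:MP = iota c.
Proof. exact: mmapC. Qed.

Definition kill Z : {rmorphism Rv -> Rv} :=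
  subst (@mpolyC _ K)
    (\matrix_(x, y) if (x, y) \in Z then 0 else 'X_(mxvec_index x y)).

Lemma subst_kill (B : comNzRingType) (iota : {rmorphism K -> B})
    (M : 'M[B]_(d, e)) Z f :
  (forall x y, (x, y) \in Z -> M x y = 0) ->
  subst iota M (kill Z f) = subst iota M f.
Proof.
move=> MZ; apply: (@eq_rmorph_mpoly _ _ _ (subst iota M \o kill Z)) => [c|i] /=.
  by rewrite !subst_const.
case/mxvec_indexP: i => x y; rewrite !subst_var mxE; case: ifP => [/MZ->|_].
  by rewrite rmorph0.
by rewrite subst_var.
Qed.

Lemma kill_kill Z Z' f : Z \subset Z' -> kill Z' (kill Z f) = kill Z' f.
Proof.
by move=> /subsetP sub; apply: subst_kill => x y /sub xyZ; rewrite mxE xyZ.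
Qed.

Definition indicator (a : {set entry}) : 'M[K]_(d, e) :=
  \matrix_(x, y) ((x, y) \in a)%:R.

Variables (phi : {rmorphism Rv -> Rv}) (W : {set entry}) (rk : entry -> nat).

(** The entries in [W] are set to zero one after another, in the order of
    increasing [rk], after applying [phi]; the primes are the kernels of the
    resulting morphisms, so they increase.  The step at the entry (x, y) is
    strict because the variable (x, y) itself is a witness: its image vanishes
    once (x, y) has been killed, and it does not vanish before, since it takes a
    nonzero value at a 0/1 point whose support [a] meets [W] only in (x, y) and
    in entries that are killed later. *)
Lemma specialization_chain :
  (forall x y, (x, y) \in W -> exists2 a : {set entry},
     subst idfun (indicator a) (phi 'X_(mxvec_index x y)) != 0 &
     forall z, z \in W -> z \in a -> z = (x, y) \/ (rk (x, y) < rk z)%N) ->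
  (forall x y Z, (x, y) \in W -> (x, y) \in Z ->
     (forall z, z \in W -> (rk z < rk (x, y))%N -> z \in Z) ->
     kill Z (phi 'X_(mxvec_index x y)) = 0) ->
  exists psi : 'I_#|W|.+1 -> {rmorphism Rv -> Rv},
    (forall i f, phi f = 0 -> psi i f = 0) /\
    forall i j : 'I_#|W|.+1, (i < j)%N ->
      (forall f, psi i f = 0 -> psi j f = 0) /\
      exists f, psi j f = 0 /\ psi i f != 0.
Proof.
move=> alive dies.
pose leR w z := (rk w <= rk z)%N; pose s := sort leR (enum W).
have leR_tr : transitive leR by move=> ? ? ?; apply: leq_trans.
have leR_refl : reflexive leR by move=> ?; apply: leqnn.
have s_sorted : sorted leR s by apply: sort_sorted => ? ?; apply: leq_total.
have s_uniq : uniq s by rewrite sort_uniq enum_uniq.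
have s_mem w : (w \in s) = (w \in W) by rewrite mem_sort mem_enum.
have s_size : size s = #|W| by rewrite size_sort cardE.
pose Z n := [set z in take n s].
exists (fun i => kill (Z i) \o phi); split=> [i f f0|i j lt_ij].
  by rewrite -[LHS]/(kill (Z i) (phi f)) f0 rmorph0.
have lt_is : (i < size s)%N.
  by rewrite s_size; apply: leq_trans lt_ij _; rewrite -ltnS.
have [x0 y0] : entry by case: (s) lt_is.
split=> [f f0|].
  rewrite -[LHS]/(kill (Z j) (phi f)) -(@kill_kill (Z i)).
    by rewrite -[kill (Z i) _]/((kill (Z i) \o phi) f) f0 rmorph0.
  apply/subsetP=> z; rewrite !inE -(subnKC (ltnW lt_ij)) takeD mem_cat.
  by move->.
case def_w : (nth (x0, y0) s i) => [x y].
have wW : (x, y) \in W by rewrite -def_w -s_mem mem_nth.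
exists 'X_(mxvec_index x y); split.
  apply: dies => // [|z zW lt_z].
    rewrite inE -def_w -(nth_take _ lt_ij) mem_nth // size_take.
    by case: ifP.
  have zs : z \in s by rewrite s_mem.
  rewrite inE -(nth_index (x0, y0) zs).
  have lt_zi : (index z s < i)%N.
    rewrite ltnNge; apply/negP => le_iz.
    have := sorted_leq_nth leR_tr leR_refl (x0, y0) s_sorted.
    move=> /(_ i (index z s)); rewrite !inE lt_is index_mem zs.
    move=> /(_ isT isT le_iz).
    by rewrite /leR nth_index // def_w leqNgt lt_z.
  have lt_zj := ltn_trans lt_zi lt_ij.
  rewrite -(nth_take _ lt_zj) mem_nth // size_take; case: ifP => // _.
  by rewrite index_mem.
have [a nza a_late] := alive x y wW; apply: contra nza => /eqP fi0.
rewrite -(@subst_kill _ _ _ (Z i)) => [|u v].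
  by rewrite -[kill (Z i) _]/((kill (Z i) \o phi) _) fi0 rmorph0.
rewrite inE mxE => uv_i; have [uv_a|//] := boolP ((u, v) \in a); exfalso.
have uv_s : (u, v) \in s by apply: mem_take uv_i.
have lt_uv : (index (u, v) s < i)%N.
  by have := uv_i; rewrite in_take.
have := a_late (u, v); rewrite -s_mem uv_s uv_a => /(_ isT isT)[eq_uv|].
  by move: lt_uv; rewrite eq_uv -def_w index_uniq // ltnn.
have := sorted_leq_nth leR_tr leR_refl (x0, y0) s_sorted.
move=> /(_ (index (u, v) s) i); rewrite !inE lt_is index_mem uv_s.
move=> /(_ isT isT (ltnW lt_uv)).
by rewrite /leR nth_index // def_w leqNgt => /negP.
Qed.

End Specialization.

(** * Blocks of columns and the sets of parameters *)

Section Blocks.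
Variables (k l : nat).
Implicit Types (y : 'I_(k * l)) (j : 'I_l).

Lemma blk_subproof y : y %/ k < l.
Proof.
have k_gt0 : 0 < k by case: k y => // -[].
by rewrite ltn_divLR // [l * k]mulnC.
Qed.

(** The block of a column, that is, the j with y in C_j. *)
Definition blk y : 'I_l := Ordinal (blk_subproof y).

Lemma blk_Y (i : 'I_k) j : blk (Y i j) = j.
Proof.
apply: val_inj; rewrite /= divnMDl ?divn_small ?addn0 //.
exact: leq_ltn_trans (ltn_ord i).
Qed.

Lemma Y_inj (i i' : 'I_k) j j' : Y i j = Y i' j' -> i = i' /\ j = j'.
Proof.
move=> eqY; have eqj : j = j' by rewrite -(blk_Y i j) eqY blk_Y.
split=> //; apply: val_inj; have := congr1 val eqY.
by rewrite /= eqj => /addnI.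
Qed.

Lemma mem_C y j : (y \in C k j) = (blk y == j).
Proof.
apply/imsetP/eqP => [[i _ ->] | <-]; first exact: blk_Y.
have k_gt0 : 0 < k by case: k y => // -[].
exists (Ordinal (ltn_pmod y k_gt0)) => //.
by apply: val_inj; rewrite /= -divn_eq.
Qed.

Lemma card_C j : #|C k j| = k.
Proof.
rewrite card_imset ?card_ord // => i i' eqY.
by have [] := Y_inj eqY.
Qed.

Variables (d : nat) (S : {set 'I_(k * l)}) (xs : 'I_l -> 'I_d)
  (ys : 'I_l -> 'I_(k * l)) (D : 'I_l -> {set 'I_d}).

(** A matrix whose blocks have rank one is determined, block by block, by one
    column [ys j] and by the row [xs j].  In the column [ys j] only the rows in
    [D j] are kept, which leaves room for a linear relation between these
    columns. *)
Definition cross : {set 'I_d * 'I_(k * l)} :=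
  [set w | (w.2 \notin S) &&
     (if w.2 == ys (blk w.2) then w.1 \in D (blk w.2)
      else w.1 == xs (blk w.2))].

Hypotheses (blk_ys : forall j, blk (ys j) = j) (ysNS : forall j, ys j \notin S).

Lemma ys_inj : injective ys.
Proof. by move=> j j' eq_ys; rewrite -(blk_ys j) eq_ys blk_ys. Qed.

Lemma card_cross : #|cross| = \sum_j #|D j| + (k * l - l - #|S|).
Proof.
rewrite -sum1_card (eq_bigr (fun w => 1)) //.
transitivity (\sum_(y : 'I_(k * l)) \sum_(x : 'I_d | (x, y) \in cross) 1).
  by rewrite (exchange_big_dep predT) //= pair_big_dep; apply: eq_bigl => -[].
rewrite (bigID (mem [set ys j | j : 'I_l])) /=; congr (_ + _).
  rewrite big_imset /=; last by move=> ? ? _ _; apply: ys_inj.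
  apply: eq_bigr => j _; rewrite -sum1_card; apply: eq_bigl => x.
  by rewrite inE /= ysNS blk_ys eqxx.
rewrite (bigID (mem S)) /= big1 => [|y /andP[_ yS]]; last first.
  by rewrite big_pred0 // => x; rewrite inE /= yS.
rewrite add0n; under eq_bigr => y.
  move=> /andP[Nys NyS]; rewrite (big_pred1 (xs (blk y))); last first.
    move=> x; rewrite inE /= NyS; case: eqP => // ysE.
    by case/negP: Nys; rewrite ysE; apply: imset_f.
  over.
rewrite sum1_card.
have -> : #|[pred y | (y \notin [set ys j | j : 'I_l]) && (y \notin S)]| =
          #|~: ([set ys j | j : 'I_l] :|: S)|.
  by apply: eq_card => y; rewrite !inE negb_or.
rewrite cardsCs setCK card_ord cardsU card_imset ?card_ord; last exact: ys_inj.
rewrite (_ : _ :&: S = set0) ?cards0 ?subn0 ?subnDA //.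
apply/setP=> y; rewrite !inE; apply/negP => /andP[/imsetP[j _ ->]].
exact/negP/ysNS.
Qed.

End Blocks.

(** * Matrices whose blocks have rank one *)

Section Points.
Import GRing.Theory.
Local Open Scope ring_scope.
Variables (K : fieldType) (d k l : nat).
Local Notation Rv := {mpoly K[d * (k * l)]}.

Lemma rmorph_minor (B : comNzRingType) (psi : {rmorphism Rv -> B})
    (A : {set 'I_d}) (E : {set 'I_(k * l)}) (eqAE : #|A| = #|E|) :
  psi (minor K eqAE) =
    \det (\matrix_(i < #|A|, j < #|A|)
            psi 'X_(mxvec_index (enum_val i) (enum_val (cast_ord eqAE j)))).
Proof.
rewrite /minor -det_map_mx; congr (\det _).
by apply/matrixP=> i j; rewrite !mxE.
Qed.

Section Vanishing.
Variables (B : idomainType) (psi : {rmorphism Rv -> B}).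
Variables (U : 'I_d -> 'I_l -> B) (V : 'I_(k * l) -> B).
Hypothesis psiUV : forall x y, psi 'X_(mxvec_index x y) = U x (blk y) * V y.

Lemma column_minors_vanish g : @column_minors K d k l 2 g -> psi g = 0.
Proof.
move=> [A [E [eqAE [[j /subsetP subE] A2 ->]]]]; rewrite rmorph_minor.
pose u (i : 'I_#|A|) := U (enum_val i) j.
pose w i := V (enum_val (cast_ord eqAE i)).
apply: (det_outer_product (u := u) (w := w)) => // i i'.
rewrite mxE psiUV; congr (U _ _ * _); apply/eqP.
by rewrite -mem_C; apply/subE/enum_valP.
Qed.

(** If the block directions are linearly dependent, then the l-minors vanish:
    such a minor is the determinant of a product of two square matrices of
    size l, the first having rows of U as its rows. *)
Lemma maximal_minors_vanish (c : 'I_l -> B) g :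
  (exists h, c h != 0) -> (forall x, \sum_h c h * U x h = 0) ->
  @minors K d k l l g -> psi g = 0.
Proof.
move=> nzc cU [A [E [eqAE [Al ->]]]]; rewrite rmorph_minor.
pose w h i := let y := enum_val (cast_ord eqAE i) in
  if blk y == h then V y else 0.
apply: (det_factor_dependent (u := fun i => U (enum_val i)) (w := w) (c := c));
  move=> // i i'.
rewrite mxE psiUV /w (bigD1 (blk (enum_val (cast_ord eqAE i')))) //= eqxx.
rewrite big1 ?addr0 // => h; rewrite eq_sym => /negPf->.
by rewrite mulr0.
Qed.

End Vanishing.

Lemma ord2_1 (i : 'I_2) : i != 0 -> i = 1.
Proof. by case: i => [[|[|]]] // lt; move=> _; apply: val_inj. Qed.

Section Pivots.
Variables (F : fieldType) (psi : {rmorphism Rv -> F}).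
Local Notation entry x y := (psi 'X_(mxvec_index x y)).
Hypothesis column_minors0 :
  forall g, @column_minors K d k l 2 g -> psi g = 0.

Lemma block_proportional x x' y y' :
  blk y = blk y' -> entry x y * entry x' y' = entry x y' * entry x' y.
Proof.
move=> eq_blk; have [->|ne_x] := eqVneq x x'; first by rewrite mulrC.
have [-> //|ne_y] := eqVneq y y'.
pose f (i : 'I_2) := if i == 0 then x else x'.
pose g (i : 'I_2) := if i == 0 then y else y'.
have two (T : eqType) (a b : T) : a != b ->
    injective (fun i : 'I_2 => if i == 0 then a else b).
  move=> ne_ab i i'; case: (i =P 0) => [->|ni]; case: (i' =P 0) => [->|ni'] //.
  - by move/eqP; rewrite (negPf ne_ab).
  - by move/eqP; rewrite eq_sym (negPf ne_ab).
  - by move/eqP in ni; move/eqP in ni'; rewrite (ord2_1 ni) (ord2_1 ni').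
have := @det_along_injections _ _ _ _ (\matrix_(u, w) entry u w) f g
  (two _ _ _ ne_x) (two _ _ _ ne_y).
rewrite det_size2 !mxE /= => det0.
apply/eqP; rewrite -subr_eq0; apply/eqP/det0 => eqAB.
transitivity (psi (minor K eqAB)).
  by rewrite rmorph_minor; congr (\det _); apply/matrixP=> i j; rewrite !mxE.
apply: column_minors0; exists _, _, eqAB; split=> //; last first.
  by rewrite card_imset ?card_ord //; apply: two.
exists (blk y); apply/subsetP=> _ /imsetP[i _ ->]; rewrite mem_C /g.
by case: ifP => // _; rewrite eq_blk.
Qed.

(** At a point of the variety every block has a nonzero entry outside S or
    vanishes outside S; a position outside S is chosen in both cases so that the
    number of coordinates does not depend on which blocks vanish. *)
Lemma pivots_exist (S : {set 'I_(k * l)}) (x0 : 'I_d) :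
  (forall j : 'I_l, exists y, blk y = j /\ y \notin S) ->
  exists (xs : 'I_l -> 'I_d) (ys : 'I_l -> 'I_(k * l)),
    (forall j, blk (ys j) = j) /\ (forall j, ys j \notin S) /\
    (forall j, entry (xs j) (ys j) != 0 \/
       forall x y, blk y = j -> y \notin S -> entry x y = 0).
Proof.
move=> free.
have /fin_all_exists[xs /fin_all_exists[ys pivot]] (j : 'I_l) :
    exists x y, [/\ blk y = j, y \notin S & entry x y != 0 \/
       forall x y, blk y = j -> y \notin S -> entry x y = 0].
  have [zero|/not_all_ex_not[x /not_all_ex_not[y]]] := classic
    (forall x y, blk y = j -> y \notin S -> entry x y = 0).
    by have [y [yj yS]] := free j; exists x0, y; split=> //; right.
  have [yj|nyj] := eqVneq (blk y) j; last by case=> /eqP; rewrite (negPf nyj).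
  have [yS|nyS] := boolP (y \in S); first by case.
  by move=> nz; exists x, y; split=> //; left; apply/eqP=> z; apply: nz.
by exists xs, ys; split; [|split] => j; have [] := pivot j.
Qed.

Lemma star_columns_dependent (ys : 'I_l -> 'I_(k * l)) :
  injective ys -> (forall g, @minors K d k l l g -> psi g = 0) ->
  exists2 a : 'I_l -> F, (exists j, a j != 0) &
    forall x, \sum_j a j * entry x (ys j) = 0.
Proof.
move=> ys_injective minors0.
have [|a nza dep] := @column_dependency F d l (\matrix_(x, j) entry x (ys j)).
  move=> q q_inj.
  have det0 := @det_along_injections _ _ _ _ (\matrix_(x, y) entry x y) q ys
    q_inj ys_injective.
  transitivity (\det (\matrix_(i < l, j < l)
      (\matrix_(x, y) entry x y) (q i) (ys j))).
    by congr (\det _); apply/matrixP=> i j; rewrite !mxE.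
  apply: det0 => eqAB; transitivity (psi (minor K eqAB)).
    by rewrite rmorph_minor; congr (\det _); apply/matrixP=> i j; rewrite !mxE.
  by apply: minors0; exists _, _, eqAB; rewrite card_imset ?card_ord.
exists a => // x; rewrite -[RHS](dep x).
by apply: eq_bigr => j _; rewrite mxE.
Qed.

Variables (S : {set 'I_(k * l)}) (n : nat) (t : 'I_n -> F).
Variables (xs : 'I_l -> 'I_d) (ys : 'I_l -> 'I_(k * l)).
Hypotheses (blk_ys : forall j, blk (ys j) = j)
  (pivot : forall j, entry (xs j) (ys j) != 0 \/
       forall x y, blk y = j -> y \notin S -> entry x y = 0).
Local Notation rational := (rational_in (psi \o @mpolyC _ K) t).

(** In a nonzero block every entry is the product of the entries in its row and
    in its column of the cross through the pivot, divided by the pivot. *)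
Lemma rational_from_pivots :
  (forall x y, y \in S -> entry x y = 0) ->
  (forall x j, rational (entry x (ys j))) ->
  (forall y, y \notin S -> y != ys (blk y) -> rational (entry (xs (blk y)) y)) ->
  forall x y, rational (entry x y).
Proof.
move=> zero ratcol ratrow x y.
have [yS|NyS] := boolP (y \in S); first by rewrite zero //; apply: rational0.
have [->|ne_y] := eqVneq y (ys (blk y)); first exact: ratcol.
have [nz|zero_blk] := pivot (blk y); last first.
  by rewrite (zero_blk _ _ erefl NyS); apply: rational0.
rewrite -[entry x y](mulfK nz) block_proportional ?blk_ys //.
apply: rationalM (rationalV _); last exact: ratcol.
by apply: rationalM; [apply: ratcol | apply: ratrow].
Qed.

End Pivots.
End Points.

(** * The two dimensions *)

Section Dimensions.
Import GRing.Theory.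
Local Open Scope ring_scope.
Variables (K : fieldType) (d k l : nat).
Local Notation Rv := {mpoly K[d * (k * l)]}.
Local Notation var x y := ('X_(mxvec_index x y) : Rv).

Lemma rational_on_set (F : fieldType) (psi : {rmorphism Rv -> F})
    (W : {set 'I_d * 'I_(k * l)}) (tau : 'I_d * 'I_(k * l) -> F) w :
  w \in W ->
  rational_in (psi \o @mpolyC _ K) (fun i : 'I_#|W| => tau (enum_val i)) (tau w).
Proof.
move=> wW; rewrite -[w in tau w](enum_rankK_in wW wW).
exact: (@rational_gen _ _ _ _ (fun i : 'I_#|W| => tau (enum_val i))).
Qed.

Section Parametrization.
Variables (S : {set 'I_(k * l)}) (xs : 'I_l -> 'I_d) (ys : 'I_l -> 'I_(k * l)).
Variables (D : 'I_l -> {set 'I_d}) (U : 'I_d -> 'I_l -> Rv).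
Hypotheses (blk_ys : forall j, blk (ys j) = j) (ysNS : forall j, ys j \notin S).

(** The chosen column of a block is the reference for its direction, so it has
    weight 1; the variable in the row [xs j] of any other column outside [S]
    serves as the weight of that column. *)
Definition weight (y : 'I_(k * l)) : Rv :=
  if y \in S then 0 else if y == ys (blk y) then 1 else var (xs (blk y)) y.

Definition param : {rmorphism Rv -> Rv} :=
  subst (@mpolyC _ K) (\matrix_(x, y) (U x (blk y) * weight y)).

Lemma param_var x y : param (var x y) = U x (blk y) * weight y.
Proof. by rewrite subst_var mxE. Qed.

Lemma param_star x j : param (var x (ys j)) = U x j.
Proof.
by rewrite param_var /weight (negPf (ysNS j)) blk_ys eqxx mulr1.
Qed.

Lemma eval_indicator a x y :
  subst idfun (indicator K a) (var x y) = ((x, y) \in a)%:R.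
Proof. by rewrite subst_var mxE. Qed.

(** The weights, which have rank 0, are specialized first.  The directions [U]
    are supposed to involve only variables in the chosen columns, so that at this
    stage it is enough that U (xs j) j is not yet zero. *)
Lemma param_chain (rk : 'I_d * 'I_(k * l) -> nat) :
  (forall w, (rk w == 0%N) = (w.2 != ys (blk w.2))) ->
  (forall j, exists2 a : {set 'I_d * 'I_(k * l)},
     subst idfun (indicator K a) (U (xs j) j) = 1 &
     forall w, w \in a -> w.2 == ys (blk w.2)) ->
  (forall a a' : {set 'I_d * 'I_(k * l)},
     (forall w, w.2 == ys (blk w.2) -> (w \in a) = (w \in a')) ->
     forall x j, subst idfun (indicator K a) (U x j) =
       subst idfun (indicator K a') (U x j)) ->
  (forall j x, x \in D j -> exists2 a : {set 'I_d * 'I_(k * l)},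
     subst idfun (indicator K a) (U x j) != 0 &
     forall z, z \in a -> z = (x, ys j) \/ (rk (x, ys j) < rk z)%N) ->
  (forall j x (Z : {set 'I_d * 'I_(k * l)}), x \in D j -> (x, ys j) \in Z ->
     (forall z, z \in cross S xs ys D -> (rk z < rk (x, ys j))%N -> z \in Z) ->
     kill K Z (U x j) = 0) ->
  exists psi : 'I_#|cross S xs ys D|.+1 -> {rmorphism Rv -> Rv},
    (forall i f, param f = 0 -> psi i f = 0) /\
    forall i j : 'I_#|cross S xs ys D|.+1, (i < j)%N ->
      (forall f, psi i f = 0 -> psi j f = 0) /\
      exists f, psi j f = 0 /\ psi i f != 0.
Proof.
move=> rk0 aliveV local aliveU diesU.
apply: (specialization_chain (rk := rk)) => [x y|x y Z]; rewrite inE /=.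
  move=> /andP[NyS]; case: eqP => [-> xD|/eqP ny /eqP->].
    move: (blk y) xD => j xD; rewrite blk_ys in xD.
    have [a nza aP] := aliveU _ _ xD; exists a; first by rewrite param_star.
    by move=> z _; apply: aP.
  have [a a1 aP] := aliveV (blk y); set w := (xs (blk y), y).
  exists (w |: a).
    rewrite param_var rmorphM /= /weight (negPf NyS) (negPf ny) eval_indicator.
    rewrite (local _ a) ?a1; first by rewrite setU11 mulr1 oner_eq0.
    move=> z z_star; rewrite !inE; case: eqP => // ez.
    by move: z_star; rewrite ez /= (negPf ny).
  move=> z _; rewrite !inE => /orP[/eqP->|/aP z_star]; [by left | right].
  have /eqP-> : rk w == 0%N by rewrite rk0.
  by rewrite lt0n rk0 negbK.
move=> /andP[NyS]; case: eqP => [-> xD|/eqP ny /eqP->] xyZ earlier.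
  move: (blk y) xD xyZ earlier => j; rewrite blk_ys => xD xyZ earlier.
  by rewrite param_star; apply: diesU xyZ earlier.
rewrite param_var rmorphM /= /weight (negPf NyS) (negPf ny).
by rewrite [X in _ * X]subst_var mxE xyZ mulr0.
Qed.

End Parametrization.

(** The variety is the product over the blocks of the cones of matrices of rank
    at most one of format d by k - s_j, where s_j < k columns of the block lie
    in S; each factor has dimension d + k - s_j - 1, and the s_j add up to k. *)
Lemma dim_ideal_S (S : {set 'I_(k * l)}) :
  (2 <= k)%N -> (k <= l)%N -> (l <= d)%N -> calL S ->
  quot_has_krull_dim (@ideal_S K d k l S) (l * (k + d - 1) - k).
Proof.
move=> k2 kl ld [it [jt [card_i card_j SE]]].
have it_inj : injective it.
  suff /imset_injP inj : #|[set it t | t : 'I_k]| == #|'I_k|.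
    by move=> t t'; apply: inj.
  by rewrite card_i card_ord.
have card_S : #|S| = k.
  rewrite SE card_imset ?card_ord // => t t' eqY; apply: it_inj.
  by have [] := Y_inj eqY.
(* A block contained in S would be all of S, which meets two blocks. *)
have free (j : 'I_l) : exists y, blk y = j /\ y \notin S.
  apply: NNPP => full.
  have subC : C k j \subset S.
    apply/subsetP=> y; rewrite mem_C => /eqP yj.
    by apply: contraT => NyS; case: full; exists y.
  have CE : C k j = S.
    by apply/eqP; rewrite eqEcard subC card_S card_C leqnn.
  have jtE t : jt t = j.
    rewrite -(blk_Y (it t) (jt t)); apply/eqP; rewrite -mem_C CE SE.
    exact: imset_f.
  have : (#|[set jt t | t : 'I_k]| <= #|[set j]|)%N.
    by apply/subset_leq_card/subsetP=> _ /imsetP[t _ ->]; rewrite jtE inE.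
  by rewrite cards1 leqNgt card_j.
have d_gt0 : (0 < d)%N by lia.
pose x0 := Ordinal d_gt0.
have card_W xs ys : (forall j, blk (ys j) = j) -> (forall j, ys j \notin S) ->
    #|cross S xs ys (fun=> [set: 'I_d])| = (l * (k + d - 1) - k)%N.
  move=> blk_ys ysNS; rewrite card_cross // card_S.
  rewrite (eq_bigr (fun=> d)) => [|j _]; last by rewrite cardsT card_ord.
  rewrite sum_nat_const card_ord.
  have : (2 * l <= k * l)%N by rewrite leq_mul2r k2 orbT.
  rewrite mulnBr mulnDr mulnC muln1; lia.
have /fin_all_exists[ys ysP] := free.
have blk_ys j : blk (ys j) = j by have [] := ysP j.
have ysNS j : ys j \notin S by have [] := ysP j.
pose xs (_ : 'I_l) := x0.
pose U x j := var x (ys j).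
pose rk (w : 'I_d * 'I_(k * l)) : nat := w.2 == ys (blk w.2).
have := @param_chain S xs ys (fun=> [set: 'I_d]) U blk_ys ysNS rk.
rewrite card_W //; case=> [|||||psi [psi0 chain]].
- by move=> w; rewrite /rk eqb0.
- move=> j; exists [set (xs j, ys j)]; first by rewrite eval_indicator inE eqxx.
  by move=> w /set1P->; rewrite /= blk_ys.
- move=> a a' eqa x j; rewrite !eval_indicator eqa //.
  by rewrite /= blk_ys.
- move=> j x _; exists [set (x, ys j)].
    by rewrite eval_indicator inE eqxx oner_eq0.
  by move=> z /set1P->; left.
- by move=> j x Z _ xyZ _; rewrite subst_var mxE xyZ.
apply: (quot_krull_dim (phi := psi)) => [F f fS f2|i g|i g|//].
- have var0 x y : y \in S -> f 'X_(mxvec_index x y) = 0.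
    by move=> yS; apply: fS; exists x, y; rewrite mxE.
  have [xs' [ys' [blk_ys' [ysNS' pivot]]]] := pivots_exist f x0 free.
  pose W := cross S xs' ys' (fun=> [set: 'I_d]).
  pose tau w := f (var w.1 w.2).
  exists #|W|, (fun i => tau (enum_val i)); split; first by rewrite card_W.
  case/mxvec_indexP => x y.
  apply: (rational_from_pivots f2 blk_ys' pivot) => // [u j|u NuS nu].
    rewrite -[f _]/(tau (u, ys' j)); apply: rational_on_set.
    by rewrite inE /= ysNS' blk_ys' eqxx in_setT.
  rewrite -[f _]/(tau (xs' (blk u), u)); apply: rational_on_set.
  by rewrite inE /= NuS (negPf nu) eqxx.
- move=> [x [y [yS ->]]]; apply: psi0.
  by rewrite mxE param_var /weight yS mulr0.
- move=> g2; apply: psi0; apply: column_minors_vanish g2 => x y.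
  exact: param_var.
Qed.

Lemma generic_count (a b c : nat) : (2 <= a)%N -> (2 <= b)%N -> (b <= c)%N ->
  (b.-1 + b.-1 * c + (a * b - b) = b * (a + c) - c - 1)%N.
Proof.
case: b => // n a2 _ le_nc; have : (n.+1 <= a * n.+1)%N by apply: leq_pmull; lia.
rewrite mulnDr [(n.+1 * c)%N]mulSn [(n.+1 * a)%N]mulnC succnK; lia.
Qed.

(** Besides the weights, the parameters are the l - 1 directions other than the
    one with index j0, and the l - 1 coefficients that express the direction j0
    in terms of them.  The coefficient of the direction h is stored in the entry
    (rho h, ys j0).  In the chain, the weights are killed first, then the entries
    of the directions off the positions (rho h, ys h), which leaves
    c_h * u_h as the entry (rho h, ys j0); now the coefficients c_h and at last
    the u_h can be killed, each of these being detected by a single variable. *)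
Lemma dim_ideal_0 :
  (2 <= k)%N -> (k <= l)%N -> (l <= d)%N ->
  quot_has_krull_dim (@ideal_0 K d k l) (l * (k + d) - d - 1).
Proof.
move=> k2 kl ld.
have l2 : (2 <= l)%N by lia.
pose rho (j : 'I_l) : 'I_d := widen_ord ld j.
have rho_inj : injective rho.
  by move=> j j' eq_rho; apply: val_inj; apply: (congr1 val eq_rho).
pose D j0 j := if j == j0 then rho @: [set~ j0] else [set: 'I_d].
have card_W xs (ys : 'I_l -> 'I_(k * l)) j0 : (forall j, blk (ys j) = j) ->
    #|cross set0 xs ys (D j0)| = (l * (k + d) - d - 1)%N.
  move=> blk_ys; rewrite card_cross // => [|j]; last by rewrite inE.
  rewrite cards0 subn0 (bigD1 j0) //= {1}/D eqxx card_imset // cardsC1 card_ord.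
  rewrite (eq_bigr (fun=> d)) => [|j /negPf nj]; last first.
    by rewrite /D nj cardsT card_ord.
  rewrite sum_nat_const cardC1 card_ord.
  exact: generic_count.
pose j0 : 'I_l := Ordinal (ltnW l2).
pose j1 : 'I_l := Ordinal l2.
have k_gt0 : (0 < k)%N by lia.
pose ys (j : 'I_l) := Y (Ordinal k_gt0) j.
have blk_ys j : blk (ys j) = j by rewrite blk_Y.
have ysN0 j : ys j \notin set0 by rewrite inE.
(* In the row rho j1 the direction j0 contains the term with the coefficient of
   the direction j1, so it is not zero there. *)
pose xs (_ : 'I_l) := rho j1.
pose c h : Rv := if h == j0 then -1 else var (rho h) (ys j0).
pose U x j : Rv := if j == j0
  then \sum_(h | h != j0) var (rho h) (ys j0) * var x (ys h)
  else var x (ys j).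
have cU x : \sum_h c h * U x h = 0.
  rewrite (bigD1 j0) //= /c /U !eqxx mulN1r addrC.
  apply/eqP; rewrite subr_eq0; apply/eqP/eq_bigr => h /negPf nh.
  by rewrite nh.
pose rk (w : 'I_d * 'I_(k * l)) : nat :=
  if w.2 != ys (blk w.2) then 0%N else
  if blk w.2 == j0 then 2%N else if w.1 == rho (blk w.2) then 3%N else 1%N.
have rk_ys x j : rk (x, ys j) =
    if j == j0 then 2%N else if x == rho j then 3%N else 1%N.
  by rewrite /rk /= blk_ys eqxx.
have j1_j0 : j1 != j0 by [].
have U_free x j : j != j0 -> U x j = var x (ys j) by rewrite /U => /negPf->.
have eval_U0 a x : subst idfun (indicator K a) (U x j0) =
    \sum_(h | h != j0) ((rho h, ys j0) \in a)%:R * ((x, ys h) \in a)%:R.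
  rewrite /U eqxx rmorph_sum; apply: eq_bigr => h _.
  by rewrite rmorphM /= !eval_indicator.
have eval_dep x h : h != j0 ->
    subst idfun (indicator K [set (rho h, ys j0); (x, ys h)]) (U x j0) = 1.
  move=> nh; rewrite eval_U0 (bigD1 h) //= !inE !eqxx orbT mulr1.
  rewrite big1 ?addr0 // => h' /andP[_ nh'].
  rewrite !inE !xpair_eqE (inj_eq rho_inj) (negPf nh') /=.
  by rewrite [ys j0 == _]eq_sym (inj_eq (ys_inj blk_ys)) (negPf nh) andbF mul0r.
have := @param_chain set0 xs ys (D j0) U blk_ys ysN0 rk.
rewrite card_W //; case=> [|||||psi [psi0 chain]].
- by move=> w; rewrite /rk; case: ifP => // _; case: ifP => // _; case: ifP.
- move=> j; have [->|nj] := eqVneq j j0.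
    exists [set (rho j1, ys j0); (xs j0, ys j1)]; first exact: eval_dep.
    by move=> w; rewrite !inE => /orP[] /eqP-> /=; rewrite blk_ys.
  exists [set (xs j, ys j)]; last by move=> w /set1P-> /=; rewrite blk_ys.
  by rewrite U_free // eval_indicator inE eqxx.
- move=> a a' eqa x j; have [->|nj] := eqVneq j j0.
    rewrite !eval_U0; apply: eq_bigr => h _.
    by rewrite !eqa //= blk_ys.
  by rewrite U_free // !eval_indicator eqa //= blk_ys.
- move=> j x; rewrite /D; have [->|nj] := eqVneq j j0.
    case/imsetP=> h; rewrite !inE => nh ->.
    exists [set (rho h, ys j0); (rho h, ys h)].
      by rewrite eval_dep ?oner_eq0.
    move=> z; rewrite !inE => /orP[] /eqP->; [by left | right].
    by rewrite !rk_ys !eqxx (negPf nh).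
  move=> _; exists [set (x, ys j)]; last by move=> z /set1P->; left.
  by rewrite U_free // eval_indicator inE eqxx oner_eq0.
- move=> j x Z; rewrite /D; have [->|nj] := eqVneq j j0; last first.
    by move=> _ xZ _; rewrite U_free // subst_var mxE xZ.
  case/imsetP=> h; rewrite !inE => nh -> hZ earlier.
  rewrite /U eqxx rmorph_sum big1 // => h' nh'.
  rewrite rmorphM /= !subst_var !mxE.
  have [->|ne_h] := eqVneq h' h; first by rewrite hZ mul0r.
  rewrite [(rho h, ys h') \in Z]earlier ?mulr0 //.
    by rewrite !inE /= blk_ys eqxx /D (negPf nh') in_setT.
  by rewrite !rk_ys eqxx (negPf nh') (inj_eq rho_inj) eq_sym (negPf ne_h).
apply: (quot_krull_dim (phi := psi)) => [F f f2 fl|i g|i g|//]; last first.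
- move=> gl; apply: psi0.
  apply: (maximal_minors_vanish (param_var set0 xs ys U) _ cU) gl.
  by exists j0; rewrite /c eqxx oppr_eq0 oner_eq0.
- move=> g2; apply: psi0; apply: column_minors_vanish g2 => x y.
  exact: param_var.
have free (j : 'I_l) : exists y, blk y = j /\ y \notin (set0 : {set 'I_(k * l)}).
  by exists (ys j); rewrite inE.
have [xs' [ys' [blk_ys' [ysN0' pivot]]]] := pivots_exist f (rho j0) free.
have [a [m nz_am] dep] := star_columns_dependent (ys_inj blk_ys') fl.
pose coef h := - (a h / a m).
have solve x : f (var x (ys' m)) = \sum_(h | h != m) coef h * f (var x (ys' h)).
  apply: (mulfI nz_am); have := dep x; rewrite (bigD1 m) //=.
  move/eqP; rewrite addr_eq0 => /eqP->; rewrite mulr_sumr -sumrN.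
  by apply: eq_bigr => h _; rewrite /coef mulrA mulrN mulrCA mulfV ?mulr1 ?mulNr.
(* The column ys' m is recovered from the other chosen columns and from the
   coefficients of the relation. *)
pose W := cross set0 xs' ys' (D m).
pose tau w := if w.2 == ys' m then \sum_(h | rho h == w.1) coef h
              else f (var w.1 w.2).
exists #|W|, (fun i => tau (enum_val i)); split; first by rewrite card_W.
have rat_col x j : j != m -> rational_in (f \o @mpolyC _ K)
    (fun i : 'I_#|W| => tau (enum_val i)) (f (var x (ys' j))).
  move=> nj; rewrite (_ : f _ = tau (x, ys' j)); last first.
    by rewrite /tau /= (inj_eq (ys_inj blk_ys')) (negPf nj).
  by apply: rational_on_set; rewrite !inE /= blk_ys' eqxx /D (negPf nj) in_setT.
case/mxvec_indexP => x y.
apply: (rational_from_pivots f2 blk_ys' pivot) => [u j|u j|u _ nu].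
- by rewrite inE.
- have [->|] := eqVneq j m; last exact: rat_col.
  rewrite solve; apply: rational_sum => h nh.
  apply: rationalM; last exact: rat_col.
  rewrite (_ : coef h = tau (rho h, ys' m)); last first.
    rewrite /tau /= eqxx (big_pred1 h) // => h'; exact: inj_eq.
  apply: rational_on_set; rewrite !inE /= blk_ys' eqxx /D eqxx.
  by apply: imset_f; rewrite !inE.
rewrite (_ : f _ = tau (xs' (blk u), u)).
  by apply: rational_on_set; rewrite !inE /= (negPf nu) eqxx.
rewrite /tau /=; case: eqP => // um.
by move: nu; rewrite um blk_ys' eqxx.
Qed.

End Dimensions.

Theorem proposition2p8 (K : fieldType) (k l d : nat)
    (k_ge2 : 2 <= k) (k_le_l : k <= l) (l_le_d : l <= d) :
  (forall S : {set 'I_(k * l)}, calL S ->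
     quot_has_krull_dim (@ideal_S K d k l S) (l * (k + d - 1) - k)) /\
  quot_has_krull_dim (@ideal_0 K d k l) (l * (k + d) - d - 1).
Proof.
split; last exact: dim_ideal_0.
by move=> S LS; apply: dim_ideal_S.
Qed.
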